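(* Let $\{q_0(x),q_1(x),\dots,q_{N-1}(x)\}\subset\mathbb{F}[x]$ be a strongly proper interpolation basis for the Birkhoff interpolation problem with conditions $\delta_{x_{\beta_1}}\circ D_x^{\alpha_1},\dots,\delta_{x_{\beta_N}}\circ D_x^{\alpha_N}$ and prescribed values $y_{\beta_1,\alpha_1},\dots,y_{\beta_N,\alpha_N}\in\mathbb{F}$. Let $g_{j,k-1}(x)$ be the associated auxiliary polynomials, let $p_{-1}(x)=0$, and for $k=1,\dots,N$ let $p_{k-1}(x)$ be the interpolation polynomial in $\mathrm{span}\{q_0,\dots,q_{k-1}\}$ for the first $k$ conditions. Then $$p_{k-1}(x)=p_{k-2}(x)+\frac{y_{\beta_k,\alpha_k}-p_{k-2}^{(\alpha_k)}(x_{\beta_k})}{g_{k-2,k-1}^{(\alpha_k)}(x_{\beta_k})}\,g_{k-2,k-1}(x),\qquad k=1,2,\dots,N.$$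
   Context: $\mathbb{F}$ is $\mathbb{R}$ or $\mathbb{C}$, $D_x=\frac{d}{dx}$, $x_0,\dots,x_n\in\mathbb{F}$ are pairwise distinct nodes, and $\delta_{x_\beta}$ is evaluation at $x_\beta$; thus $\delta_{x_\beta}\circ D_x^{\alpha}(p)=p^{(\alpha)}(x_\beta)$. The $N$ interpolation conditions $\delta_{x_{\beta_1}}\circ D_x^{\alpha_1},\dots,\delta_{x_{\beta_N}}\circ D_x^{\alpha_N}$ (with $\beta_i\in\{0,\dots,n\}$, $\alpha_i\in\mathbb{N}=\{0,1,2,\dots\}$) are ordered so that $\alpha_1\le\alpha_2\le\dots\le\alpha_N$, and $\beta_s<\beta_{s+1}$ whenever $\alpha_s=\alpha_{s+1}$. Proper basis: polynomials $q_0,\dots,q_{i-1}$ form a proper interpolation basis for the first $i$ conditions if they form a basis of an $i$-dimensional subspace $\mathcal{F}\subset\mathbb{F}[x]$ such that for any prescribed values $y_1,\dots,y_i\in\mathbb{F}$ there is a unique $p\in\mathcal{F}$ with $p^{(\alpha_l)}(x_{\beta_l})=y_l$, $l=1,\dots,i$. Strongly proper basis: $\{q_0,\dots,q_{N-1}\}$ is a strongly proper interpolation basis if for each $i=1,\dots,N$, $\{q_0,\dots,q_{i-1}\}$ is a proper interpolation basis for the first $i$ conditions. For $k=1,\dots,N$, $V_{k-1}$ is the $k\times k$ matrix whose $(r,c)$ entry is $q_{c-1}^{(\alpha_r)}(x_{\beta_r})$, $1\le r,c\le k$. Interpolation polynomial for the first $k$ conditions: $$p_{k-1}(x):=\big(q_0(x),\dots,q_{k-1}(x)\big)\,V_{k-1}^{-1}\,\big(y_{\beta_1,\alpha_1},\dots,y_{\beta_k,\alpha_k}\big)^{\mathrm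 T},$$ i.e. the unique element of $\mathrm{span}\{q_0,\dots,q_{k-1}\}$ with $p_{k-1}^{(\alpha_l)}(x_{\beta_l})=y_{\beta_l,\alpha_l}$ for $l=1,\dots,k$. Auxiliary polynomials: for $k=1,\dots,N$, $g_{-1,k-1}(x):=q_{k-1}(x)$, and for $j=0,1,\dots,k-2$, $$g_{j,k-1}(x):=q_{k-1}(x)-\big(q_0(x),\dots,q_j(x)\big)\,V_j^{-1}\,\big(q_{k-1}^{(\alpha_1)}(x_{\beta_1}),\dots,q_{k-1}^{(\alpha_{j+1})}(x_{\beta_{j+1}})\big)^{\mathrm T}$$ (a Schur complement of $V_j$). *)

(* Defs.v *)
From HB Require Import structures.
From mathcomp Require Import all_boot all_order all_algebra.
From mathcomp Require Import reals complex.

Set Implicit Arguments.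
Unset Strict Implicit.
Unset Printing Implicit Defensive.

Import GRing.Theory.
Local Open Scope ring_scope.

(* F is exactly R or C; [ground R b] makes one statement cover both cases. *)
Variant real_or_complex := Reals | Complexes.

Definition ground (R : realType) (b : real_or_complex) : numFieldType :=
  match b with
  | Reals => R
  | Complexes => R[i]
  end.

Section Birkhoff.
Variables (F : fieldType) (n : nat) (x : 'I_n.+1 -> F).

(* A family of [k] conditions is given by its derivation orders
   [alpha : 'I_k -> nat] and its node indices [beta : 'I_k -> 'I_n.+1].
   Families are indexed from 0, so index [i] here is index [i + 1] for
   conditions in the usual numbering, and index [i] for basis polynomials. *)

Definition cond (a : nat) (b : 'I_n.+1) (p : {poly F}) : F := p^`(a).[x b].

Definition ordered_conds (N : nat) (alpha : 'I_N -> nat)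
    (beta : 'I_N -> 'I_n.+1) : Prop :=
  forall s t : 'I_N, t = s.+1 :> nat ->
    (alpha s <= alpha t)%N /\ (alpha s = alpha t -> (beta s < beta t)%N).

Definition prefix (T : Type) (N k : nat) (hk : (k <= N)%N) (f : 'I_N -> T) :
  'I_k -> T := fun i => f (widen_ord hk i).

Definition lin_indep (k : nat) (q : 'I_k -> {poly F}) : Prop :=
  forall c : 'I_k -> F, \sum_(i < k) c i *: q i = 0 -> forall i, c i = 0.

Definition in_span (k : nat) (q : 'I_k -> {poly F}) (p : {poly F}) : Prop :=
  exists c : 'I_k -> F, p = \sum_(i < k) c i *: q i.

(* [{poly F}] is infinite-dimensional, hence not a [vectType]: the subspace
   with basis [q] is given by the predicate [in_span q]. *)
Definition proper_basis (k : nat) (alpha : 'I_k -> nat)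
    (beta : 'I_k -> 'I_n.+1) (q : 'I_k -> {poly F}) : Prop :=
  lin_indep q /\
  forall v : 'I_k -> F, exists! p : {poly F},
    in_span q p /\ forall l : 'I_k, cond (alpha l) (beta l) p = v l.

Definition strongly_proper_basis (N : nat) (alpha : 'I_N -> nat)
    (beta : 'I_N -> 'I_n.+1) (q : 'I_N -> {poly F}) : Prop :=
  forall (k : nat) (hk : (k <= N)%N), (0 < k)%N ->
    proper_basis (prefix hk alpha) (prefix hk beta) (prefix hk q).

Definition cond_mx (k : nat) (alpha : 'I_k -> nat) (beta : 'I_k -> 'I_n.+1)
    (q : 'I_k -> {poly F}) : 'M[F]_k :=
  \matrix_(r < k, c < k) cond (alpha r) (beta r) (q c).

(* The polynomial (q_0, ..., q_(k-1)) V^-1 v^T with V = cond_mx alpha beta q. *)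
Definition fit (k : nat) (alpha : 'I_k -> nat) (beta : 'I_k -> 'I_n.+1)
    (q : 'I_k -> {poly F}) (v : 'I_k -> F) : {poly F} :=
  \sum_(c < k) (invmx (cond_mx alpha beta q) *m \col_(r < k) v r) c ord0 *: q c.

Section Family.
Variables (N : nat) (alpha : 'I_N -> nat) (beta : 'I_N -> 'I_n.+1).
Variable q : 'I_N -> {poly F}.

(* Interpolation polynomial p_(k-1) for the first [k] conditions; for [k = 0]
   the sum is empty and p_(-1) = 0. Only the values [y b a] with [(a, b)] one
   of the conditions are used. *)
Definition interp_poly (y : 'I_n.+1 -> nat -> F) (k : nat) (hk : (k <= N)%N) :
    {poly F} :=
  fit (prefix hk alpha) (prefix hk beta) (prefix hk q)
    (prefix hk (fun r => y (beta r) (alpha r))).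

(* [aux_poly hm i] is g_(m-1, i); for [m = 0] it is g_(-1, i) = q_i. *)
Definition aux_poly (m : nat) (hm : (m <= N)%N) (i : 'I_N) : {poly F} :=
  q i - fit (prefix hm alpha) (prefix hm beta) (prefix hm q)
          (prefix hm (fun r => cond (alpha r) (beta r) (q i))).

Lemma interp_poly0 y (h0 : (0 <= N)%N) : interp_poly y h0 = 0.
Proof. by rewrite /interp_poly /fit big_ord0. Qed.

Lemma aux_poly0 (h0 : (0 <= N)%N) i : aux_poly h0 i = q i.
Proof. by rewrite /aux_poly /fit big_ord0 subr0. Qed.

End Family.
End Birkhoff.

(* Main.v *)
(** Uniqueness of interpolation in the span of [q_0, ..., q_(k-1)] carries the
    proof: [g_(k-2,k-1)] lies in that span and satisfies the first [k - 1]
    conditions with value 0.  It is nonzero by linear independence, so its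
    [k]-th condition cannot vanish; a suitable multiple of it corrects [p_(k-2)]
    at the last condition without disturbing the previous ones. *)

Require Import Defs.
From HB Require Import structures.
From mathcomp Require Import all_boot all_order all_algebra.
From mathcomp Require Import reals complex.

Set Implicit Arguments.
Unset Strict Implicit.
Unset Printing Implicit Defensive.

Import GRing.Theory.
Local Open Scope ring_scope.

Section Interpolation.
Variables (F : fieldType) (n : nat) (x : 'I_n.+1 -> F).

Lemma cond0 a b : cond x a b 0 = 0.
Proof. by rewrite /cond linear0 horner0. Qed.

Lemma condD a b (p r : {poly F}) :
  cond x a b (p + r) = cond x a b p + cond x a b r.
Proof. by rewrite /cond derivnD hornerD. Qed.

Lemma condZ a b c (p : {poly F}) : cond x a b (c *: p) = c * cond x a b p.
Proof. by rewrite /cond derivnZ hornerZ. Qed.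

Lemma condB a b (p r : {poly F}) :
  cond x a b (p - r) = cond x a b p - cond x a b r.
Proof. by rewrite /cond derivnB hornerD hornerN. Qed.

Lemma cond_lincomb a b k (c : 'I_k -> F) (q : 'I_k -> {poly F}) :
  cond x a b (\sum_(i < k) c i *: q i) = \sum_(i < k) c i * cond x a b (q i).
Proof.
rewrite (big_morph (cond x a b) (@condD a b) (cond0 a b)).
by apply: eq_bigr => i _; rewrite condZ.
Qed.

Section Fixed.
Variables (k : nat) (alpha : 'I_k -> nat) (beta : 'I_k -> 'I_n.+1).
Variable q : 'I_k -> {poly F}.

(** A kernel vector of [cond_mx] holds the coefficients of a combination of the [q i] on which every
    condition vanishes. Uniqueness for zero data makes this combination 0, and linear independence
    then makes the coefficients 0. *)
Lemma proper_basis_cond_mx_unit :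
  proper_basis x alpha beta q -> cond_mx x alpha beta q \in unitmx.
Proof.
case=> q_free interp; rewrite -unitmx_tr -row_free_unit.
apply: inj_row_free => v v0.
have [p [_ p_uniq]] := interp (fun=> 0).
have sum0 : \sum_(i < k) v 0 i *: q i = 0.
  (* Both the combination and 0 interpolate zero data, so both equal [p]. *)
  rewrite -(p_uniq (\sum_(i < k) v 0 i *: q i)).
    apply: p_uniq; split=> [|l]; last exact: cond0.
    by exists (fun=> 0); rewrite big1 // => i _; rewrite scale0r.
  split=> [|l]; first by exists (v 0).
  rewrite cond_lincomb; move/rowP/(_ l): v0; rewrite !mxE => v0l.
  by rewrite -[RHS]v0l; apply: eq_bigr => i _; rewrite !mxE.
by apply/rowP=> i; rewrite mxE; apply: q_free.
Qed.

Lemma fit_in_span v : in_span q (fit x alpha beta q v).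
Proof. by eexists. Qed.

Lemma eq_fit v w :
  v =1 w -> fit x alpha beta q v = fit x alpha beta q w.
Proof.
move=> vw; rewrite /fit; suff -> : \col_r v r = \col_r w r by [].
by apply/colP=> r; rewrite !mxE.
Qed.

Hypothesis V_unit : cond_mx x alpha beta q \in unitmx.

Lemma cond_fit v l : cond x (alpha l) (beta l) (fit x alpha beta q v) = v l.
Proof.
rewrite cond_lincomb; set u := _ *m _.
have : cond_mx x alpha beta q *m u = \col_r v r by rewrite mulKVmx.
by move: u => u /colP/(_ l); rewrite !mxE => <-; apply: eq_bigr => i _; rewrite mulrC mxE.
Qed.

(** If [p] has coefficient vector [c], its vector of conditions is [V *m c], from which the inverse
    of [V] recovers [c]. *)
Lemma fit_cond p : in_span q p ->
  fit x alpha beta q (fun l => cond x (alpha l) (beta l) p) = p.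
Proof.
case=> c ->; rewrite /fit; set w := \col_r _.
have -> : w = cond_mx x alpha beta q *m \col_i c i.
  apply/colP=> l; rewrite !mxE cond_lincomb.
  by apply: eq_bigr => i _; rewrite !mxE mulrC.
by rewrite mulKmx //; apply: eq_bigr => i _; rewrite mxE.
Qed.

Lemma fitP v p : in_span q p ->
  (forall l, cond x (alpha l) (beta l) p = v l) -> fit x alpha beta q v = p.
Proof. by move=> /fit_cond {2}<- pv; apply: eq_fit => l; rewrite pv. Qed.

End Fixed.

(** Keeping track of the last coefficient allows linear independence to be applied to it later. Here
    [ltn_ord k] reads as [k.+1 <= N] and selects the prefix of length [k.+1], while its [ltnW]
    selects that of length [k]. *)
Lemma span_recr N (q : 'I_N -> {poly F}) (k : 'I_N) p a :
  in_span (Defs.prefix (ltnW (ltn_ord k)) q) p ->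
  exists2 c : 'I_k.+1 -> F, c ord_max = a &
    p + a *: q k = \sum_(i < k.+1) c i *: Defs.prefix (ltn_ord k) q i.
Proof.
case=> c ->.
(* [unlift ord_max i] is [None] exactly at the last index, where the default [a] is taken. *)
exists (fun i => oapp c a (unlift ord_max i)); first by rewrite unlift_none.
rewrite big_ord_recr /= unlift_none /=; congr (_ + _ *: _); last first.
  by congr q; apply: val_inj.
apply: eq_bigr => i _.
have -> : widen_ord (leqnSn k) i = lift ord_max i.
  by apply: ord_inj; rewrite lift_max.
rewrite liftK /=; congr (_ *: _); rewrite /Defs.prefix; congr q.
by apply: ord_inj; rewrite /= -[LHS]lift_max.
Qed.

Lemma forall_prefix_recr N (P : 'I_N -> Prop) (k : 'I_N) :
  (forall i : 'I_k, P (widen_ord (ltnW (ltn_ord k)) i)) -> P k ->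
  forall i : 'I_k.+1, P (widen_ord (ltn_ord k) i).
Proof.
move=> Plt Pk i; case: (ltnP i k) => ik.
  have -> // : widen_ord (ltn_ord k) i
    = widen_ord (ltnW (ltn_ord k)) (Ordinal ik) by apply: val_inj.
have -> // : widen_ord (ltn_ord k) i = k.
by apply/val_inj/eqP; rewrite eqn_leq /= -ltnS ltn_ord.
Qed.

Section Recursion.
Variables (N : nat) (alpha : 'I_N -> nat) (beta : 'I_N -> 'I_n.+1).
Variable q : 'I_N -> {poly F}.
Hypothesis q_strongly_proper : strongly_proper_basis x alpha beta q.

Lemma prefix_cond_mx_unit k (hk : (k <= N)%N) :
  cond_mx x (Defs.prefix hk alpha) (Defs.prefix hk beta) (Defs.prefix hk q)
    \in unitmx.
Proof.
(* Strong properness speaks of nonempty prefixes only; the empty matrix has determinant 1. *)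
case: k hk => [|k] hk; first by rewrite unitmxE det_mx00 unitr1.
exact/proper_basis_cond_mx_unit/q_strongly_proper.
Qed.

Lemma cond_interp_poly y k (hk : (k <= N)%N) (l : 'I_k) :
  let i := widen_ord hk l in
  cond x (alpha i) (beta i) (interp_poly x alpha beta q y hk)
    = y (beta i) (alpha i).
Proof. exact/cond_fit/prefix_cond_mx_unit. Qed.

Lemma cond_aux_poly m (hm : (m <= N)%N) i (l : 'I_m) :
  let j := widen_ord hm l in
  cond x (alpha j) (beta j) (aux_poly x alpha beta q hm i) = 0.
Proof.
by move=> j; rewrite condB (cond_fit (prefix_cond_mx_unit hm)) subrr.
Qed.

Variable k : 'I_N.
Let g := aux_poly x alpha beta q (ltnW (ltn_ord k)) k.

(** Since [g] is [q k] minus an element of the span of the earlier [q i], adding [a *: g]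
    contributes exactly [a] at [q k]. *)
Lemma aux_poly_span_recr p a :
  in_span (Defs.prefix (ltnW (ltn_ord k)) q) p ->
  exists2 c : 'I_k.+1 -> F, c ord_max = a &
    p + a *: g = \sum_(i < k.+1) c i *: Defs.prefix (ltn_ord k) q i.
Proof.
case=> c ->; rewrite /g /aux_poly scalerBr addrCA addrC.
apply: span_recr.
set f := fit _ _ _ _ _.
have [d ->] : in_span (Defs.prefix (ltnW (ltn_ord k)) q) f.
  exact: fit_in_span.
exists (fun i => c i - a * d i).
rewrite scaler_sumr -sumrB; apply: eq_bigr => i _.
by rewrite scalerBl scalerA.
Qed.

Lemma cond_aux_poly_neq0 : cond x (alpha k) (beta k) g != 0.
Proof.
apply/eqP=> gk0.
have span0 : in_span (Defs.prefix (ltnW (ltn_ord k)) q) 0.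
  by exists (fun=> 0); rewrite big1 // => i _; rewrite scale0r.
(* Taking [p = 0] and [a = 1] expands [g] itself, with coefficient 1 at [q k]. *)
have [c c1] := aux_poly_span_recr 1 span0; rewrite add0r scale1r => gE.
have fit0 : fit x (Defs.prefix (ltn_ord k) alpha)
    (Defs.prefix (ltn_ord k) beta) (Defs.prefix (ltn_ord k) q) (fun=> 0) = 0.
  rewrite /fit; have -> : \col_(_ < k.+1) (0 : F) = 0.
    by apply/colP=> i; rewrite !mxE.
  by rewrite mulmx0 big1 // => i _; rewrite mxE scale0r.
(* With [gk0], all [k.+1] conditions vanish on [g], so [g] is the interpolant of zero data. *)
have g0 : g = 0.
  rewrite -fit0; apply/esym/fitP => [||]; first exact: prefix_cond_mx_unit.
    by exists c.
  apply: (forall_prefix_recr (P := fun i => cond x (alpha i) (beta i) g = 0)).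
    exact: cond_aux_poly.
  exact: gk0.
have [q_free _] := q_strongly_proper (ltn_ord k) (ltn0Sn k).
have := q_free c; rewrite -gE g0 => /(_ erefl ord_max).
by rewrite c1 => /eqP; rewrite oner_eq0.
Qed.

Lemma interp_poly_recr y :
  let p := interp_poly x alpha beta q y (ltnW (ltn_ord k)) in
  interp_poly x alpha beta q y (ltn_ord k) =
  p + ((y (beta k) (alpha k) - cond x (alpha k) (beta k) p)
       / cond x (alpha k) (beta k) g) *: g.
Proof.
move=> p; set a := _ / _.
apply: fitP; first exact: prefix_cond_mx_unit.
  have [|c _ ->] := @aux_poly_span_recr p a; first exact: fit_in_span.
  by exists c.
(* On the first [k] conditions [g] contributes 0; at condition [k] the factor [a] supplies exactly
   the missing difference. *)
apply: (forall_prefix_recr (P := fun i =>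
  cond x (alpha i) (beta i) (p + a *: g) = y (beta i) (alpha i))) => [i|].
  by rewrite condD condZ cond_aux_poly mulr0 addr0 cond_interp_poly.
by rewrite condD condZ divfK ?cond_aux_poly_neq0 // addrC subrK.
Qed.

End Recursion.
End Interpolation.

(** Division by 0 returns 0 here, so the nonvanishing of the denominator is stated alongside the
    formula to make the quotient a genuine one. *)
Theorem theorem7 (R : realType) (b : real_or_complex) (n : nat)
    (x : 'I_n.+1 -> ground R b) (x_inj : injective x)
    (N : nat) (alpha : 'I_N -> nat) (beta : 'I_N -> 'I_n.+1)
    (conds_ordered : ordered_conds alpha beta)
    (q : 'I_N -> {poly ground R b})
    (q_strongly_proper : strongly_proper_basis x alpha beta q)
    (y : 'I_n.+1 -> nat -> ground R b) (k : 'I_N) :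
  let p_prev := interp_poly x alpha beta q y (ltnW (ltn_ord k)) in
  let p_cur := interp_poly x alpha beta q y (ltn_ord k) in
  let g := aux_poly x alpha beta q (ltnW (ltn_ord k)) k in
  cond x (alpha k) (beta k) g != 0 /\
  p_cur = p_prev
    + ((y (beta k) (alpha k) - cond x (alpha k) (beta k) p_prev)
       / cond x (alpha k) (beta k) g) *: g.
Proof. by split; [exact: cond_aux_poly_neq0 | exact: interp_poly_recr]. Qed.
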